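(* For every positive integer $n$ there exists a connected finite simple graph $H$ such that $$\mathrm{v}(I(H))-\deg\big(h_{R/I(H)}(t)\big)=n,$$ where $R=\mathbb{K}[V(H)]$ for any field $\mathbb{K}$.
   Context: For a graph $H$, $R=\mathbb{K}[V(H)]$ is the polynomial ring over a field $\mathbb{K}$ in the vertices, and $I(H)=(x_ix_j\mid\{x_i,x_j\}\in E(H))$ is the edge ideal. The v-number of a proper graded ideal $I\subseteq R$ is $\mathrm{v}(I)=\min\{d\ge0\mid\exists f\in R_d,\ \mathfrak p\in\mathrm{Ass}(I),\ I:(f)=\mathfrak p\}$. The Hilbert series of $R/I$ is written uniquely as $h_{R/I}(t)/(1-t)^{\dim(R/I)}$ with $h_{R/I}(t)\in\mathbb{Z}[t]$, $h_{R/I}(1)\ne0$; $h_{R/I}(t)$ is the $h$-polynomial. *)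

(* Defs.v *)
From mathcomp Require Import all_boot all_order all_algebra.
From mathcomp Require Import fingraph.
From mathcomp Require Import mpoly.
Set Implicit Arguments. Unset Strict Implicit. Unset Printing Implicit Defensive.
Import GRing.Theory.
Local Open Scope ring_scope.

Definition simple_graph (m : nat) (e : rel 'I_m) : Prop :=
  irreflexive e /\ ssrbool.symmetric e.

Definition connected_graph (m : nat) (e : rel 'I_m) : Prop :=
  (0 < m)%N /\ forall x y : 'I_m, connect e x y.

Definition ideal_of (K : fieldType) (m : nat) := {mpoly K[m]} -> Prop.

Definition edge_ideal (K : fieldType) (m : nat) (e : rel 'I_m) : ideal_of K m :=
  fun f => exists g : 'I_m * 'I_m -> {mpoly K[m]},
    f = \sum_(p : 'I_m * 'I_m | e p.1 p.2) g p * ('X_p.1 * 'X_p.2).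

Definition is_ideal (K : fieldType) (m : nat) (I : ideal_of K m) : Prop :=
  I 0 /\ (forall a b, I a -> I b -> I (a + b)) /\ (forall r a, I a -> I (r * a)).

Definition prime_ideal (K : fieldType) (m : nat) (P : ideal_of K m) : Prop :=
  is_ideal P /\ ~ P 1 /\ (forall a b, P (a * b) -> P a \/ P b).

Definition colon (K : fieldType) (m : nat) (I : ideal_of K m) (f : {mpoly K[m]}) : ideal_of K m :=
  fun g => I (g * f).

Definition same_ideal (K : fieldType) (m : nat) (I J : ideal_of K m) : Prop :=
  forall g, I g <-> J g.

Definition Ass (K : fieldType) (m : nat) (I : ideal_of K m) (P : ideal_of K m) : Prop :=
  prime_ideal P /\ exists g, same_ideal P (colon I g).

(* f in R_d : f is homogeneous of degree d (0 included) *)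
Definition homogeneous (K : fieldType) (m : nat) (d : nat) (f : {mpoly K[m]}) : bool :=
  all (fun mn : 'X_{1..m} => mdeg mn == d) (msupp f).

Definition vnum_witness (K : fieldType) (m : nat) (I : ideal_of K m) (d : nat) : Prop :=
  exists f, homogeneous d f /\ exists P, Ass I P /\ same_ideal (colon I f) P.

Definition is_vnumber (K : fieldType) (m : nat) (I : ideal_of K m) (v : nat) : Prop :=
  vnum_witness I v /\ forall d, (d < v)%N -> ~ vnum_witness I d.

Definition indep_mod (K : fieldType) (m : nat) (I : ideal_of K m) (d k : nat) : Prop :=
  exists f : 'I_k -> {mpoly K[m]}, (forall i, homogeneous d (f i)) /\
    forall c : 'I_k -> K, I (\sum_(i < k) c i *: f i) -> forall i, c i = 0.

Definition is_hilbfun (K : fieldType) (m : nat) (I : ideal_of K m) (HF : nat -> nat) : Prop :=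
  forall d, indep_mod I d (HF d) /\ ~ indep_mod I d (HF d).+1.

(* h is the h-polynomial: sum_d HF(d) t^d = h(t)/(1-t)^D with h(1) <> 0 *)
Definition is_hpoly (K : fieldType) (m : nat) (I : ideal_of K m) (h : {poly int}) : Prop :=
  exists (HF : nat -> nat) (D : nat), is_hilbfun I HF /\
    (forall k, h`_k = \sum_(j < k.+1) ((1 - 'X) ^+ D : {poly int})`_j * (HF (k - j)%N)%:Z) /\
    h.[1] != 0.

(* Main.v *)
Require Import Defs.
From mathcomp Require Import all_boot all_order all_algebra.
From mathcomp Require Import fingraph mpoly.
From mathcomp Require Import ring zify.
Set Implicit Arguments. Unset Strict Implicit. Unset Printing Implicit Defensive.
Import GRing.Theory Num.Theory.
Local Open Scope ring_scope.

(* The v-number of an edge ideal is the least size of an independent set A such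
   that V \ N(A) is independent.  The Hilbert series is P(t/(1-t)), where P is
   the independence polynomial; hence every factor 1+x of P lowers the degree of
   the h-polynomial by one without changing the Krull dimension.

   Writing * for the join and + for the disjoint union of graphs, take
   Z = 2K3 * 3K2 * 3K2  and  Y = (2K2 + K4) * (K2 + K6).  Then
   P_Z = (1+x)^2 (1+16x) and P_Y - 1 = 16x (1+x)^2.  In n disjoint copies of
   Z * Y, join all copies of Y to each other.  The resulting connected graph has
     P = P_Z^n + n (P_Y - 1) P_Z^(n-1) = (1+x)^(2n) (1+16x)^(n-1) (1+16(n+1)x),
   so that its h-polynomial has degree n, while its v-number is 2n. *)

(** * Edge ideals and independent sets *)

Section Graph.
Variables (m : nat) (e : rel 'I_m).
Implicit Types (A D : {set 'I_m}) (mn : 'X_{1..m}).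

Definition indep A := [forall x in A, forall y in A, ~~ e x y].
Definition nbh A := [set y | [exists x in A, e x y]].
(** The parameter [D] covers induced subgraphs, so deleting marked vertices does not change the
    vertex type. *)
Definition indep_poly D : {poly int} :=
  \sum_(A : {set 'I_m} | (A \subset D) && indep A) 'X^#|A|.

(* For [D = setT] the best such [k] is the v-number of the edge ideal. *)
Definition v_lower D (k : nat) := forall A, A \subset D ->
  indep A -> indep (D :\: nbh A) -> (k <= #|A|)%N.
(** [M] holds marked vertices that the witness must dominate; this condition lets witnesses survive
    gluing along the marks. *)
Definition v_witness (M : {set 'I_m}) (k : nat) := exists A, [/\ M \subset nbh A,
  indep A, indep (~: nbh A) & #|A| = k].

Lemma indepP A :
  reflect (forall x y, x \in A -> y \in A -> ~~ e x y) (indep A).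
Proof.
apply: (iffP forall_inP) => [h x y xA yA | h x xA].
  by move/forall_inP: (h _ xA) => /(_ _ yA).
by apply/forall_inP=> y; apply: h.
Qed.

Lemma nbhP A y : reflect (exists2 x, x \in A & e x y) (y \in nbh A).
Proof. by rewrite inE; apply: exists_inP. Qed.

Definition msupport mn := [set i | (0 < mn i)%N].

Lemma card_msupport mn : (#|msupport mn| <= mdeg mn)%N.
Proof.
rewrite mdegE -sum1_card big_mkcond /=; apply: leq_sum => i _.
by rewrite inE; case: (mn i).
Qed.

Variable K : fieldType.
Implicit Types (f g : {mpoly K[m]}).

Hypothesis irr_e : irreflexive e.
Hypothesis sym_e : ssrbool.symmetric e.

Lemma edge_ideal0 : @edge_ideal K m e 0.
Proof. by exists (fun _ => 0); rewrite big1 // => p _; rewrite mul0r. Qed.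

Lemma edge_idealD f g : edge_ideal e f -> edge_ideal e g -> edge_ideal e (f + g).
Proof.
case=> a -> [b ->]; exists (fun p => a p + b p).
by rewrite -big_split; apply: eq_bigr => p _; rewrite mulrDl.
Qed.

Lemma edge_ideal_sum (I : eqType) (r : seq I) (F : I -> {mpoly K[m]}) :
  (forall i, i \in r -> edge_ideal e (F i)) -> edge_ideal e (\sum_(i <- r) F i).
Proof.
move=> h; rewrite big_seq; apply: (big_ind (@edge_ideal K m e)) => //.
  exact: edge_ideal0.
exact: edge_idealD.
Qed.

Lemma edge_ideal_mulX f x y : e x y -> edge_ideal e (f * ('X_x * 'X_y)).
Proof.
move=> exy; exists (fun p => if p == (x, y) then f else 0).
rewrite (bigD1 (x, y)) //= eqxx big1 ?addr0 // => p /andP [_ /negbTE ->].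
by rewrite mul0r.
Qed.

Lemma mcoeffMX_notle f mn u : ~~ (u <= mn)%MM -> (f * 'X_[u])@_mn = 0.
Proof.
move=> h; apply: memN_msupp_eq0; rewrite (perm_mem (msuppMX _ _)).
by apply/mapP => -[w _ hw]; rewrite hw lem_addr in h.
Qed.

Lemma edge_idealP f :
  edge_ideal e f <-> forall mn, indep (msupport mn) -> f@_mn = 0.
Proof.
split=> [[g ->] mn /indepP ind | h].
  rewrite raddf_sum big1 //= => -[x y] /= exy.
  rewrite -mpolyXD mcoeffMX_notle //; apply/negP => /mnm_lepP le_xy.
  have := ind x y; rewrite !inE exy.
  have := le_xy x; have := le_xy y; rewrite !mnmDE !mnm1E !eqxx addn1 add1n.
  by move=> /(leq_ltn_trans (leq0n _)) -> /(leq_ltn_trans (leq0n _)) -> /(_ isT isT).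
rewrite [f]mpolyE; apply: edge_ideal_sum => mn mn_f.
have /forall_inPn[x xA /forall_inPn[y yA]] : ~~ indep (msupport mn).
  by apply/negP=> /h /eqP; apply/negP; rewrite -mcoeff_msupp.
rewrite negbK => exy.
(* Irreflexivity gives [x != y], so the edge monomial is squarefree and divides [mn]. *)
have le_xy : (U_(x) + U_(y) <= mn)%MM.
  apply/mnm_lepP => i; rewrite mnmDE !mnm1E; move: xA yA; rewrite !inE.
  have : x != y by apply/eqP => E; rewrite E irr_e in exy.
  by case: (eqVneq x i) => [->|_]; case: (eqVneq y i) => [->|_] //; rewrite eqxx.
by rewrite -(submK le_xy) mpolyXD scalerAl mpolyXD; apply: edge_ideal_mulX.
Qed.

(** * Monomial primes and the v-number *)

Lemma mcoeff_kill (C : {set 'I_m}) g mn :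
  (g \mPo [tuple if i \in C then 0 else 'X_i | i < m])@_mn =
    if [disjoint msupport mn & C] then g@_mn else 0.
Proof.
rewrite comp_mpolyE raddf_sum /=.
pose F mu := if [disjoint msupport mu & C] then 'X_[mu] else 0 : {mpoly K[m]}.
rewrite (eq_bigr (fun mu => (g@_mu *: F mu)@_mn)); last first.
  move=> mu _; congr (_ *: _)@_mn; rewrite /F; case: ifP => dis.
    rewrite (mpolyXE_id _ mu); apply: eq_bigr => i _; rewrite tnth_mktuple.
    case: ifP => // iC; rewrite -['X_i ^+ _]expr1.
    have /eqP -> : mu i == 0%N; last by rewrite !expr0.
    rewrite -leqn0 leqNgt; apply/negP=> mui.
    by have := disjointFr dis (x := i); rewrite inE mui iC => /(_ isT).
  move: dis; rewrite disjoint_subset => /negbT /subsetPn[i]; rewrite !inE negbK.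
  move=> mui iC; rewrite (bigD1 i) //= tnth_mktuple iC.
  by rewrite expr0n -(negbK (_ == _)) -lt0n mui mul0r.
case: (boolP (mn \in msupp g)) => [mng | mng].
  rewrite (bigD1_seq mn) //= big1_seq ?addr0.
    rewrite mcoeffZ /F; case: ifP => _; last by rewrite mcoeff0 mulr0.
    by rewrite mcoeffX eqxx mulr1.
  move=> mu /andP[ne _]; rewrite mcoeffZ /F; case: ifP => _.
    by rewrite mcoeffX (negbTE ne) mulr0.
  by rewrite mcoeff0 mulr0.
rewrite (memN_msupp_eq0 mng) if_same big1_seq // => mu /= mug.
rewrite mcoeffZ /F; case: ifP => _; last by rewrite mcoeff0 mulr0.
rewrite mcoeffX; case: eqP => [E|_]; last by rewrite mulr0.
by rewrite -E mug in mng.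
Qed.

Lemma kill_eq0 (C : {set 'I_m}) g :
  g \mPo [tuple if i \in C then 0 else 'X_i | i < m] = 0 <->
  forall mn, [disjoint msupport mn & C] -> g@_mn = 0.
Proof.
split=> [h mn dis | h].
  by have := mcoeff_kill C g mn; rewrite h dis mcoeff0.
by apply/mpolyP => mn; rewrite mcoeff_kill mcoeff0; case: ifP => // /h.
Qed.

(** This is the ideal generated by the variables in [C], presented as the kernel of the homomorphism
    that sets them to 0; it is prime because the target is a domain. *)
Lemma prime_ideal_kill (C : {set 'I_m}) : prime_ideal
  (fun g : {mpoly K[m]} => g \mPo [tuple if i \in C then 0 else 'X_i | i < m] = 0).
Proof.
split; [split; [|split] | split].
- exact: comp_mpoly0.
- by move=> a b ha hb; rewrite comp_mpolyD ha hb addr0.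
- by move=> r a ha; rewrite rmorphM /= ha mulr0.
- by rewrite comp_mpoly1; apply/eqP; apply: oner_neq0.
- move=> a b; rewrite rmorphM /= => /eqP; rewrite mulf_eq0.
  by case/orP => /eqP; [left | right].
Qed.

(** Take for f the product of the variables in [A]. A neighbour of [A] times f lies in the ideal,
    and since the vertices outside [nbh A] are independent, the colon ideal is generated by the
    variables in [nbh A]. *)
Lemma vnum_witness_exists k :
  v_witness set0 k -> vnum_witness (@edge_ideal K m e) k.
Proof.
case=> A [_ /indepP indA /indepP indN cardA].
pose u := [multinom (i \in A : nat) | i < m]%MM.
have colonE g : colon (edge_ideal e) 'X_[u] g <->
    g \mPo [tuple if i \in nbh A then 0 else 'X_i | i < m] = 0.
  rewrite /colon edge_idealP kill_eq0; split=> h mn dis.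
    have := h (u + mn)%MM; rewrite mcoeffMX; apply.
    (* An independent [A] avoids its own neighbourhood, and [mn] avoids it by assumption. *)
    have subN : {subset msupport (u + mn)%MM <= ~: nbh A}.
      move=> i; rewrite in_setC inE mnmDE mnmE addn_gt0 lt0b => /orP[iA | mni].
        by apply/nbhP => -[x xA]; apply/negP/indA.
      by have := disjointFr dis (x := i); rewrite inE => ->.
    by apply/indepP => x y /subN xN /subN yN; apply: indN.
  case: (boolP (u <= mn)%MM) => [le_u | nle]; last exact: mcoeffMX_notle.
  rewrite -(submK le_u) addmC mcoeffMX; apply: h.
  rewrite disjoint_subset; apply/subsetP => y; rewrite !inE mnmBE => gt0.
  apply/exists_inPn => x xA; apply/negP => exy.
  have xmn : x \in msupport mn.
    by rewrite inE; have /mnm_lepP/(_ x) := le_u; rewrite mnmE xA.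
  have ymn : y \in msupport mn by rewrite inE (leq_trans gt0) ?leq_subr.
  by have := indepP _ dis _ _ xmn ymn; rewrite exy.
exists 'X_[u]; split.
  rewrite /homogeneous msuppX /= andbT mdegE.
  rewrite -cardA -sum1_card [X in _ == X]big_mkcond /=.
  by apply/eqP/eq_bigr => i _; rewrite mnmE; case: (i \in A).
exists (fun g => g \mPo [tuple if i \in nbh A then 0 else 'X_i | i < m] = 0).
split; last exact: colonE.
by split; [exact: prime_ideal_kill | exists 'X_[u] => g; rewrite colonE].
Qed.

(** As 1 is not in P, some monomial [mn] of f has independent support A, with at most [d] vertices.
    A variable in P must be adjacent to A, since otherwise its product with [mn] survives modulo the
    ideal. Each edge has an end in P by primality, so the complement of N(A) is independent. *)
Lemma vnum_witness_lower k d :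
  v_lower setT k -> vnum_witness (@edge_ideal K m e) d -> (k <= d)%N.
Proof.
move=> low [f [hom [P [[[_ [P1 Pprime]] _] fP]]]].
have : ~~ all (fun mn => ~~ indep (msupport mn)) (msupp f).
  apply/negP => /allP h; apply: P1; apply/fP; rewrite /colon mul1r.
  apply/edge_idealP => mn ind; apply: memN_msupp_eq0; apply/negP.
  by move/h; rewrite ind.
case/allPn => mn mn_f; rewrite negbK => ind.
have <- : mdeg mn = d by apply/eqP; have /allP -> := hom.
apply: leq_trans (card_msupport mn); apply: low => //.
have PX x : P 'X_x -> x \in nbh (msupport mn).
  move/fP; rewrite /colon mulrC edge_idealP => /(_ (U_(x) + mn)%MM).
  rewrite mcoeffMX => h; apply/negPn/negP => xN.
  move: mn_f; rewrite mcoeff_msupp => /eqP; case; apply: h.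
  have sup i : i \in msupport (U_(x) + mn)%MM -> i = x \/ i \in msupport mn.
    rewrite !inE mnmDE mnm1E; case: (eqVneq x i) => [->|_] //=; first by left.
    by right.
  have nx i : i \in msupport mn -> ~~ e i x.
    by move=> imn; apply: contra xN => eix; apply/nbhP; exists i.
  apply/indepP => y z /sup[-> | ymn] /sup[-> | zmn].
  - by rewrite irr_e.
  - by rewrite sym_e nx.
  - exact: nx.
  - exact: (indepP _ ind).
apply/indepP => x y; rewrite !in_setD !in_setT !andbT => xN yN.
apply/negP => exy; have : P ('X_x * 'X_y).
  apply/fP; rewrite /colon mulrC; exact: edge_ideal_mulX.
by case/Pprime => /PX; apply/negP.
Qed.

Lemma is_vnumber_edge_ideal k :
  v_lower setT k -> v_witness set0 k -> is_vnumber (@edge_ideal K m e) k.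
Proof.
move=> low wit; split; first exact: vnum_witness_exists.
by move=> d; rewrite ltnNge => /negP h /(vnum_witness_lower low).
Qed.

(** * The Hilbert function counts monomials with independent support *)

Definition faces d : {set {ffun 'I_m -> 'I_d.+1}} :=
  [set phi : {ffun 'I_m -> 'I_d.+1} | (\sum_i phi i == d)%N && indep [set i | (0 < phi i)%N]].

Definition mnm_of d (phi : {ffun 'I_m -> 'I_d.+1}) : 'X_{1..m} :=
  [multinom (phi i : nat) | i < m].

Lemma mnm_of_inj d : injective (@mnm_of d).
Proof.
move=> phi psi /mnmP h; apply/ffunP => i; apply: val_inj.
by have := h i; rewrite !mnmE.
Qed.

Lemma msupport_mnm_of d (phi : {ffun 'I_m -> 'I_d.+1}) :
  msupport (mnm_of phi) = [set i | (0 < phi i)%N].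
Proof. by apply/setP => i; rewrite !inE mnmE. Qed.

(** No exponent exceeds the total degree, so the finite exponent type ['I_d.+1] loses no monomial of
    degree [d]. *)
Lemma mnm_of_surj d mn : mdeg mn = d -> indep (msupport mn) ->
  exists2 phi, phi \in faces d & mn = mnm_of phi.
Proof.
move=> deg ind.
have le i : (mn i < d.+1)%N by rewrite ltnS -deg mdegE (bigD1 i) // leq_addr.
pose phi := [ffun i => inord (mn i) : 'I_d.+1].
have E : mn = mnm_of phi by apply/mnmP => i; rewrite mnmE ffunE inordK.
exists phi => //; rewrite inE -msupport_mnm_of -E ind andbT.
by apply/eqP; rewrite -[RHS]deg mdegE; apply: eq_bigr => i _; rewrite E mnmE.
Qed.

Lemma indep_mod_faces d : indep_mod (@edge_ideal K m e) d #|faces d|.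
Proof.
exists (fun i => 'X_[mnm_of (enum_val i)]); split=> [i | c].
  rewrite /homogeneous msuppX /= andbT.
  have := enum_valP i; rewrite inE => /andP[/eqP deg _].
  by apply/eqP; rewrite mdegE -[RHS]deg; apply: eq_bigr => j _; rewrite mnmE.
rewrite edge_idealP => h i; have := h (mnm_of (enum_val i)).
rewrite msupport_mnm_of; have := enum_valP i; rewrite inE => /andP[_ ->].
move/(_ isT); rewrite raddf_sum (bigD1 i) //= mcoeffZ mcoeffX eqxx mulr1.
rewrite big1 ?addr0 // => j ji; rewrite mcoeffZ mcoeffX.
by rewrite (inj_eq (@mnm_of_inj d)) (inj_eq enum_val_inj) (negbTE ji) mulr0.
Qed.

(** The coefficient matrix on the face monomials has more rows than columns, so a nonzero row vector
    kills it; the corresponding combination has no face monomial left and lies in the ideal. *)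
Lemma indep_mod_max d : ~ indep_mod (@edge_ideal K m e) d #|faces d|.+1.
Proof.
case=> f [hom ind].
pose M := \matrix_(i < #|faces d|.+1, j < #|faces d|)
  (f i)@_(mnm_of (enum_val j)).
have : kermx M != 0.
  rewrite -mxrank_eq0 mxrank_ker subn_eq0 -ltnNge ltnS; exact: rank_leq_col.
case/rowV0Pn => v /sub_kermxP vM /eqP[].
apply/rowP => i; rewrite mxE; apply: (ind (fun i => v 0 i)).
rewrite edge_idealP => mn indmn; rewrite raddf_sum /=.
under eq_bigr do rewrite mcoeffZ.
case: (eqVneq (mdeg mn) d) => [deg | deg].
  have [phi phiF ->] := mnm_of_surj deg indmn.
  have /rowP/(_ (enum_rank_in phiF phi)) := vM; rewrite !mxE => E.
  rewrite -[RHS]E.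
  by apply: eq_bigr => j _; rewrite mxE enum_rankK_in.
rewrite big1 // => j _; rewrite memN_msupp_eq0 ?mulr0 //.
by apply: contra deg; have /allP := hom j; apply.
Qed.

Lemma is_hilbfun_faces : is_hilbfun (@edge_ideal K m e) (fun d => #|faces d|).
Proof. by move=> d; split; [exact: indep_mod_faces | exact: indep_mod_max]. Qed.

End Graph.

(** * The Hilbert series from the independence polynomial *)

(** The series t/(1-t) cut off after degree [N], which keeps the computation inside polynomials. *)
Definition truncated_geom N : {poly int} := \poly_(i < N.+1) (0 < i)%N%:R.

Definition eq_upto N (p q : {poly int}) := forall k, (k <= N)%N -> p`_k = q`_k.

Lemma eq_uptoM N p p' q q' :
  eq_upto N p p' -> eq_upto N q q' -> eq_upto N (p * q) (p' * q').
Proof.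
move=> hp hq k kN; rewrite !coefM; apply: eq_bigr => j _.
by rewrite hp ?hq // (leq_trans _ kN) ?leq_subr // -ltnS.
Qed.

Lemma eq_uptoX N p q a : eq_upto N p q -> eq_upto N (p ^+ a) (q ^+ a).
Proof. by move=> h; elim: a => // a IHa; rewrite !exprS; apply: eq_uptoM. Qed.

Lemma truncated_geom_upto N d : (d <= N)%N ->
  eq_upto d (truncated_geom N) (truncated_geom d).
Proof. by move=> dN k kd; rewrite !coef_poly !ltnS kd (leq_trans kd dN). Qed.

Lemma mul_truncated_geom N : eq_upto N ((1 - 'X) * truncated_geom N) 'X.
Proof.
move=> k kN; rewrite mulrBl mul1r coefB coefXM coefX !coef_poly !ltnS kN.
by case: k kN => [|[|k]] // kN; rewrite /= ltnW // subrr.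
Qed.

Section HilbertSeries.
Variables (m : nat) (e : rel 'I_m).

(** Each vertex of [A] independently chooses a positive exponent, and every other vertex the
    exponent 0, so the sum factors over the vertices. *)
Lemma sum_support_eq N (A : {set 'I_m}) :
  \sum_(phi : {ffun 'I_m -> 'I_N.+1} | [set i | (0 < phi i)%N] == A)
    'X^(\sum_i phi i) = truncated_geom N ^+ #|A|.
Proof.
have <- : \prod_(i < m) \sum_(v < N.+1 | (0 < v)%N == (i \in A)) 'X^v
    = truncated_geom N ^+ #|A|.
  rewrite -prodr_const [RHS]big_mkcond; apply: eq_bigr => i _.
  case: ifP => _.
    rewrite /truncated_geom poly_def big_mkcond; apply: eq_bigr => v _.
    by case: (0 < v)%N; rewrite ?scale1r ?scale0r.
  rewrite (bigD1 ord0) //= big1 ?addr0 // => v /andP[v0 /negP[]].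
  by rewrite -val_eqE /=; case: (nat_of_ord v) v0.
rewrite bigA_distr_big_dep; apply: eq_big => [phi | phi _].
  apply/eqP/forallP => [<- i | h].
    by rewrite unfold_in inE.
  by apply/setP => i; have /eqP hi : (0 < phi i)%N == (i \in A) := h i; rewrite inE.
exact: expr_sum.
Qed.

(** This reads the Hilbert function off P(t/(1-t)). Lowering the cutoff from [N] to [d] keeps the
    coefficient and gives exponents of the type used by [faces]. *)
Lemma coef_sum_truncated_geom N d : (d <= N)%N ->
  (\sum_(A | indep e A) truncated_geom N ^+ #|A|)`_d = #|faces e d|%:Z.
Proof.
move=> dN; rewrite coef_sum.
under eq_bigr do rewrite (eq_uptoX _ (truncated_geom_upto dN)) // -sum_support_eq.
rewrite -coef_sum.
have -> : \sum_(A | indep e A)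
    \sum_(phi : {ffun 'I_m -> 'I_d.+1} | [set i | (0 < phi i)%N] == A)
      'X^(\sum_i phi i) = \sum_(phi : {ffun 'I_m -> 'I_d.+1}
      | indep e [set i | (0 < phi i)%N]) 'X^(\sum_i phi i) :> {poly int}.
  rewrite (partition_big (fun phi : {ffun 'I_m -> 'I_d.+1} =>
    [set i | (0 < phi i)%N]) (indep e)) //.
  apply: eq_bigr => A indA; apply: eq_bigl => phi.
  by case: eqP => [->|_]; rewrite ?indA ?andbF.
rewrite coef_sum -sum1_card -natz natr_sum big_mkcond [RHS]big_mkcond.
apply: eq_bigr => phi _; rewrite inE coefXn andbC eq_sym.
by case: (indep _ _) => //=; case: eqP.
Qed.

(** For P of degree at most [D] this is (1-t)^D P(t/(1-t)) with denominators cleared. *)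
Definition hpoly_of (D : nat) (P : {poly int}) : {poly int} :=
  \sum_(i < D.+1) P`_i *: ('X^i * (1 - 'X) ^+ (D - i)).

Lemma hpoly_of_indep_poly D : (size (indep_poly e setT) <= D.+1)%N ->
  hpoly_of D (indep_poly e setT) =
    \sum_(A | indep e A) 'X^#|A| * (1 - 'X) ^+ (D - #|A|) /\
  forall A, indep e A -> (#|A| <= D)%N.
Proof.
move=> szP.
have EP : indep_poly e setT = \sum_(A | indep e A) 'X^#|A|.
  by apply: eq_bigl => A; rewrite subsetT.
have leD A : indep e A -> (#|A| <= D)%N.
  move=> indA; rewrite -ltnS; apply: leq_trans szP; rewrite ltnNge.
  (* All contributions to a coefficient are nonnegative, so the 1 coming from [A] cannot cancel. *)
  apply/negP => /leq_sizeP/(_ _ (leqnn _)); rewrite EP coef_sum (bigD1 A) //=.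
  rewrite coefXn eqxx => /eqP; rewrite paddr_eq0 ?ler01 //.
  by apply: sumr_ge0 => B _; rewrite coefXn ler0n.
split=> //; rewrite EP /hpoly_of.
under eq_bigr do rewrite coef_sum scaler_suml.
rewrite exchange_big /=; apply: eq_bigr => A indA.
have ltD : (#|A| < D.+1)%N by rewrite ltnS leD.
rewrite (bigD1 (Ordinal ltD)) //= coefXn eqxx scale1r big1 ?addr0 // => i.
by rewrite -val_eqE /= coefXn => /negbTE ->; rewrite scale0r.
Qed.

Lemma is_hpoly_edge_ideal (K : fieldType) D h :
  irreflexive e -> (size (indep_poly e setT) <= D.+1)%N ->
  h = hpoly_of D (indep_poly e setT) -> h.[1] != 0 ->
  is_hpoly (@edge_ideal K m e) h.
Proof.
move=> irr szP hE h1; exists (fun d => #|faces e d|), D; split; last split=> //.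
  exact: is_hilbfun_faces.
have [hS leD] := hpoly_of_indep_poly szP; move=> k; rewrite hE hS.
(* Of the [D] factors 1-t, [#|A|] turn the truncated series into powers of t, up to degree [k]. *)
transitivity (((1 - 'X) ^+ D * \sum_(A | indep e A) truncated_geom k ^+ #|A|)`_k).
  rewrite mulr_sumr !coef_sum; apply: eq_bigr => A /leD AD.
  rewrite -{2}(subnK AD) exprD -mulrA -exprMn mulrC.
  by apply/esym; apply: (@eq_uptoM k) => //; apply/eq_uptoX/mul_truncated_geom.
rewrite coefM; apply: eq_bigr => j _.
by rewrite coef_sum_truncated_geom ?leq_subr.
Qed.
End HilbertSeries.

(** With x = t/(1-t) one has (1-t)(1+ax) = 1+(a-1)t. For a = 1 the new factor is 1, which is the
    source of the degree drop. *)
Lemma hpoly_of_linear D (a : nat) (P : {poly int}) : (size P <= D.+1)%N ->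
  hpoly_of D.+1 ((1 + a%:R * 'X) * P) = (1 + (a%:R - 1) * 'X) * hpoly_of D P.
Proof.
move=> szP; rewrite /hpoly_of.
have E (i : nat) : ((1 + a%:R * 'X) * P)`_i =
    P`_i + (if i == 0%N then 0 else a%:R * P`_i.-1).
  rewrite mulrDl mul1r coefD -mulrA -polyC_natr coefCM coefXM.
  by case: (i == 0%N); rewrite ?mulr0.
under eq_bigr do rewrite E scalerDl.
(* The top term of the first sum vanishes by the size bound, the bottom term of the shifted sum by
   the default 0. *)
rewrite big_split /= big_ord_recr /= (nth_default 0 szP) scale0r addr0.
rewrite [X in _ + X]big_ord_recl /= scale0r add0r mulr_sumr -big_split /=.
apply: eq_bigr => i _; have iD : (i <= D)%N by rewrite -ltnS.
rewrite subSn // subSS exprS exprS -!mul_polyC polyCM -polyC_natr; ring.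
Qed.

(** * Gluing two graphs along marked vertices *)

(** One operation for all constructions: empty marks give the disjoint union, full marks the
    join. *)
Definition glue m1 m2 (e1 : rel 'I_m1) (e2 : rel 'I_m2)
    (M1 : {set 'I_m1}) (M2 : {set 'I_m2}) : rel 'I_(m1 + m2) :=
  fun u v => match split u, split v with
  | inl x, inl y => e1 x y
  | inr x, inr y => e2 x y
  | inl x, inr y | inr y, inl x => (x \in M1) && (y \in M2)
  end.

Definition set_sum m1 m2 (A1 : {set 'I_m1}) (A2 : {set 'I_m2}) :
    {set 'I_(m1 + m2)} :=
  [set u | match split u with inl x => x \in A1 | inr y => y \in A2 end].

Section Glue.
Variables (m1 m2 : nat) (e1 : rel 'I_m1) (e2 : rel 'I_m2).
Variables (M1 : {set 'I_m1}) (M2 : {set 'I_m2}).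
Local Notation e := (glue e1 e2 M1 M2).

Lemma splitl (x : 'I_m1) : split (lshift m2 x) = inl x.
Proof. exact: (unsplitK (inl x)). Qed.

Lemma splitr (y : 'I_m2) : split (rshift m1 y) = inr y.
Proof. exact: (unsplitK (inr y)). Qed.

Definition splitE := (splitl, splitr).

Lemma ord_sum_ind (P : 'I_(m1 + m2) -> Prop) :
  (forall x, P (lshift m2 x)) -> (forall y, P (rshift m1 y)) -> forall u, P u.
Proof. by move=> hl hr u; rewrite -(splitK u); case: (split u). Qed.

Lemma in_set_sumE (A1 : {set 'I_m1}) (A2 : {set 'I_m2}) :
  ((forall x, (lshift m2 x \in set_sum A1 A2) = (x \in A1)) *
   (forall y, (rshift m1 y \in set_sum A1 A2) = (y \in A2)))%type.
Proof. by split=> ?; rewrite inE splitE. Qed.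

Lemma set_sum_preim (A : {set 'I_(m1 + m2)}) :
  set_sum [set x | lshift m2 x \in A] [set y | rshift m1 y \in A] = A.
Proof. by apply/setP; apply: ord_sum_ind => ?; rewrite in_set_sumE inE. Qed.

Lemma card_set_sum (A1 : {set 'I_m1}) (A2 : {set 'I_m2}) : #|set_sum A1 A2| = (#|A1| + #|A2|)%N.
Proof.
rewrite -!sum1_card big_mkcond big_split_ord /= [X in _ = (X + _)%N]big_mkcond.
rewrite [X in _ = (_ + X)%N]big_mkcond /=.
by congr (_ + _)%N; apply: eq_bigr => i _; rewrite in_set_sumE.
Qed.

Lemma set_sum_sub (A1 D1 : {set 'I_m1}) (A2 D2 : {set 'I_m2}) :
  (set_sum A1 A2 \subset set_sum D1 D2) = (A1 \subset D1) && (A2 \subset D2).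
Proof.
apply/subsetP/andP => [h | [/subsetP h1 /subsetP h2]].
  by split; apply/subsetP => z zA; [have := h (lshift m2 z) | have := h (rshift m1 z)];
    rewrite !in_set_sumE; apply.
by apply: ord_sum_ind => ?; rewrite !in_set_sumE; [apply: h1 | apply: h2].
Qed.

Lemma set_sumT : set_sum [set: 'I_m1] [set: 'I_m2] = setT.
Proof. by apply/setP; apply: ord_sum_ind => ?; rewrite in_set_sumE !inE. Qed.

Lemma set_sumC (A1 : {set 'I_m1}) (A2 : {set 'I_m2}) : ~: set_sum A1 A2 = set_sum (~: A1) (~: A2).
Proof.
by apply/setP; apply: ord_sum_ind => ?; rewrite in_setC !in_set_sumE in_setC.
Qed.

Lemma indep_glue (A1 : {set 'I_m1}) (A2 : {set 'I_m2}) : indep e (set_sum A1 A2) =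
  [&& indep e1 A1, indep e2 A2 & [disjoint A1 & M1] || [disjoint A2 & M2]].
Proof.
apply/indepP/and3P => [h | [/indepP h1 /indepP h2 h12]].
  split.
  - apply/indepP => x y xA yA; have := h (lshift m2 x) (lshift m2 y).
    by rewrite !in_set_sumE /glue !splitE; apply.
  - apply/indepP => x y xA yA; have := h (rshift m1 x) (rshift m1 y).
    by rewrite !in_set_sumE /glue !splitE; apply.
  apply/negPn/negP; rewrite negb_or => /andP[/pred0Pn[x /andP[/= xA xM]]].
  move=> /pred0Pn[y /andP[/= yA yM]].
  have := h (lshift m2 x) (rshift m1 y).
  by rewrite !in_set_sumE /glue !splitE xM yM => /(_ xA yA).
have no x y : x \in A1 -> y \in A2 -> ~~ ((x \in M1) && (y \in M2)).
  move=> xA yA; case/orP: h12 => dis.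
    by rewrite (disjointFr dis xA).
  by rewrite (disjointFr dis yA) andbF.
by apply: ord_sum_ind => x; apply: ord_sum_ind => y;
  rewrite !in_set_sumE /glue !splitE => xA yA; auto.
Qed.

(** Inclusion-exclusion: an independent set misses [M1] or misses [M2], and the subtracted term
    corrects for those missing both. *)
Lemma indep_poly_glue (D1 : {set 'I_m1}) (D2 : {set 'I_m2}) :
  indep_poly e (set_sum D1 D2) =
    indep_poly e1 D1 * indep_poly e2 (D2 :\: M2)
    + indep_poly e1 (D1 :\: M1) * indep_poly e2 D2
    - indep_poly e1 (D1 :\: M1) * indep_poly e2 (D2 :\: M2).
Proof.
(* Conditions become 0/1 factors, so the identity can be checked separately for each pair of
   traces. *)
pose F (b : bool) (k : nat) : {poly int} := if b then 'X^k else 0.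
pose f1 (A1 : {set 'I_m1}) := F ((A1 \subset D1) && indep e1 A1) #|A1|.
pose g1 (A1 : {set 'I_m1}) := F [disjoint A1 & M1] 0%N * f1 A1.
pose f2 (A2 : {set 'I_m2}) := F ((A2 \subset D2) && indep e2 A2) #|A2|.
pose g2 (A2 : {set 'I_m2}) := F [disjoint A2 & M2] 0%N * f2 A2.
have -> : indep_poly e1 D1 = \sum_A1 f1 A1 by rewrite /indep_poly big_mkcond.
have -> : indep_poly e2 D2 = \sum_A2 f2 A2 by rewrite /indep_poly big_mkcond.
have -> : indep_poly e1 (D1 :\: M1) = \sum_A1 g1 A1.
  rewrite /indep_poly big_mkcond; apply: eq_bigr => A _; rewrite subsetD /g1 /f1 /F.
  by case: (A \subset D1) => //=; case: [disjoint _ & _]; case: (indep e1 A);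
    rewrite ?mul0r ?mulr0 ?mul1r.
have -> : indep_poly e2 (D2 :\: M2) = \sum_A2 g2 A2.
  rewrite /indep_poly big_mkcond; apply: eq_bigr => A _; rewrite subsetD /g2 /f2 /F.
  by case: (A \subset D2) => //=; case: [disjoint _ & _]; case: (indep e2 A);
    rewrite ?mul0r ?mulr0 ?mul1r.
rewrite /indep_poly (reindex (fun p : {set 'I_m1} * {set 'I_m2} => set_sum p.1 p.2)) /=.
  rewrite !big_distrlr /= !pair_big /= -big_split /= -sumrB [LHS]big_mkcond /=.
  apply: eq_bigr => -[A1 A2] _ /=.
  rewrite set_sum_sub indep_glue card_set_sum /g1 /g2 /f1 /f2 /F.
  case: (A1 \subset D1); case: (A2 \subset D2); case: (indep e1 A1);
    case: (indep e2 A2); case: [disjoint A1 & M1]; case: [disjoint A2 & M2];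
    rewrite /= ?exprD; ring.
exists (fun A : {set 'I_(m1 + m2)} => ([set x | lshift m2 x \in A], [set y | rshift m1 y \in A])).
  move=> [A1 A2] _ /=; congr (_, _); apply/setP => z; by rewrite inE in_set_sumE.
by move=> A _; apply: set_sum_preim.
Qed.

Lemma nbh_glue (A1 : {set 'I_m1}) (A2 : {set 'I_m2}) : nbh e (set_sum A1 A2) =
  set_sum (nbh e1 A1 :|: (if [disjoint A2 & M2] then set0 else M1))
          (nbh e2 A2 :|: (if [disjoint A1 & M1] then set0 else M2)).
Proof.
apply/setP; apply: ord_sum_ind => z; rewrite in_set_sumE in_setU.
  apply/nbhP/orP => [[u] | [/nbhP[x xA exz] | ]].
  - elim/ord_sum_ind: u => x; rewrite in_set_sumE /glue !splitE => xA.
      by move=> exz; left; apply/nbhP; exists x.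
    case/andP=> zM xM; right; case: ifP => // dis.
    by rewrite (disjointFr dis xA) in xM.
  - by exists (lshift m2 x); rewrite ?in_set_sumE // /glue !splitE.
  case: ifP => [_ | /pred0Pn[x /andP[/= xA xM]] zM]; first by rewrite inE.
  by exists (rshift m1 x); rewrite ?in_set_sumE // /glue !splitE zM.
apply/nbhP/orP => [[u] | [/nbhP[x xA exz] | ]].
- elim/ord_sum_ind: u => x; rewrite in_set_sumE /glue !splitE => xA; last first.
    by move=> exz; left; apply/nbhP; exists x.
  case/andP=> xM zM; right; case: ifP => // dis.
  by rewrite (disjointFr dis xA) in xM.
- by exists (rshift m1 x); rewrite ?in_set_sumE // /glue !splitE.
case: ifP => [_ | /pred0Pn[x /andP[/= xA xM]] zM]; first by rewrite inE.
by exists (lshift m2 x); rewrite ?in_set_sumE // /glue !splitE xM.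
Qed.

(* If [A] meets [M1] then it misses [M2] and dominates it, so that [A] cuts
   out a witness in [D2 :\: M2]. *)
Lemma v_lower_glue (D1 : {set 'I_m1}) (D2 : {set 'I_m2}) k1 k2 l1 l2 k :
  v_lower e1 D1 k1 -> v_lower e2 D2 k2 ->
  v_lower e1 (D1 :\: M1) l1 -> v_lower e2 (D2 :\: M2) l2 ->
  (k <= k1 + k2)%N ->
  (~~ [disjoint D1 & M1] -> k <= k1 + l2)%N ->
  (~~ [disjoint D2 & M2] -> k <= l1 + k2)%N ->
  v_lower e (set_sum D1 D2) k.
Proof.
move=> vk1 vk2 vl1 vl2 le_k le_k1 le_k2 A; rewrite -(set_sum_preim A).
set A1 := finset _; set A2 := finset _.
rewrite set_sum_sub indep_glue nbh_glue setDE set_sumC.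
have setI_sum (B1 C1 : {set 'I_m1}) (B2 C2 : {set 'I_m2}) :
    set_sum B1 B2 :&: set_sum C1 C2 = set_sum (B1 :&: C1) (B2 :&: C2).
  by apply/setP; apply: ord_sum_ind => ?; rewrite in_setI !in_set_sumE in_setI.
rewrite setI_sum -!setDE indep_glue card_set_sum.
case/andP=> sub1 sub2 /and3P[ind1 ind2 dis] /and3P[N1 N2 _].
move: dis N1 N2.
case: (boolP [disjoint A1 & M1]) => [dis1 | ndis1];
  case: (boolP [disjoint A2 & M2]) => [dis2 | ndis2] //= _; rewrite ?setU0 => N1 N2.
- by apply: (leq_trans le_k); apply: leq_add; [apply: vk1 | apply: vk2].
- have nD2 : ~~ [disjoint D2 & M2].
    by apply: contra ndis2; apply: disjointWl sub2.
  apply: leq_trans (le_k2 nD2) _; apply: leq_add; last exact: vk2.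
  by apply: vl1; rewrite ?subsetD ?sub1 // setDDl setUC.
have nD1 : ~~ [disjoint D1 & M1].
  by apply: contra ndis1; apply: disjointWl sub1.
apply: leq_trans (le_k1 nD1) _; apply: leq_add; first exact: vk1.
by apply: vl2; rewrite ?subsetD ?sub2 // setDDl setUC.
Qed.

Lemma disjoint_dominated m (e0 : rel 'I_m) (A M : {set 'I_m}) :
  M \subset nbh e0 A -> indep e0 A -> [disjoint A & M].
Proof.
move=> /subsetP dom /indepP ind; apply/pred0Pn => -[y /andP[/= yA /dom]].
by case/nbhP => x xA exy; have := ind _ _ xA yA; rewrite exy.
Qed.

(** Each witness dominates its marks and hence contains none. No new edge meets the union of the
    witnesses, and none lies among the undominated vertices. *)
Lemma v_witness_glue k1 k2 : v_witness e1 M1 k1 -> v_witness e2 M2 k2 ->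
  v_witness e (set_sum M1 M2) (k1 + k2).
Proof.
case=> A1 [dom1 ind1 N1 <-] [A2 [dom2 ind2 N2 <-]]; exists (set_sum A1 A2).
have dis1 := disjoint_dominated dom1 ind1.
have dis2 := disjoint_dominated dom2 ind2.
rewrite nbh_glue dis1 dis2 !setU0 set_sumC set_sum_sub !indep_glue card_set_sum.
have disN : [disjoint ~: nbh e1 A1 & M1] by rewrite disjoints_subset setCS.
by rewrite dom1 dom2 ind1 ind2 N1 N2 dis1 disN.
Qed.

End Glue.

(** A nonempty set on the left dominates the whole right side of a join, so all right vertices may
    be marked. *)
Lemma v_witness_join m1 m2 (e1 : rel 'I_m1) (e2 : rel 'I_m2) k :
  (0 < k)%N -> v_witness e1 set0 k ->
  v_witness (glue e1 e2 setT setT) (set_sum set0 setT) k.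
Proof.
move=> k0 [A [_ ind N cardA]]; exists (set_sum A set0).
have dis (B : {set 'I_m1}) : [disjoint B & [set: 'I_m1]] = (B == set0).
  by rewrite disjoints_subset setCT subset0.
have A0 : A != set0 by rewrite -cards_eq0 cardA -lt0n.
have d0 : [disjoint set0 & [set: 'I_m2]] by rewrite -setI_eq0 set0I.
have i0 : indep e2 set0 by apply/indepP => x; rewrite inE.
rewrite nbh_glue dis (negbTE A0) d0 setU0 setUT set_sumC setCT set_sum_sub.
by rewrite !indep_glue card_set_sum ind N i0 d0 !orbT sub0set subsetT cards0 addn0.
Qed.

Lemma v_witness_sub m (e : rel 'I_m) (M M' : {set 'I_m}) k :
  M \subset M' -> v_witness e M' k -> v_witness e M k.
Proof. by move=> sub [A [dom ? ? ?]]; exists A; split=> //; apply: subset_trans dom. Qed.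

Lemma glue_simple m1 m2 (e1 : rel 'I_m1) (e2 : rel 'I_m2) M1 M2 :
  simple_graph e1 -> simple_graph e2 -> simple_graph (glue e1 e2 M1 M2).
Proof.
move=> [irr1 sym1] [irr2 sym2]; split.
  by apply: ord_sum_ind => x; rewrite /glue splitE.
by apply: ord_sum_ind => x; apply: ord_sum_ind => y; rewrite /glue !splitE.
Qed.

(** Every vertex reaches a mark on its side, and two marks on one side are linked through a mark on
    the other. *)
Lemma glue_connected m1 m2 (e1 : rel 'I_m1) (e2 : rel 'I_m2) M1 M2 x1 x2 :
  simple_graph (glue e1 e2 M1 M2) -> x1 \in M1 -> x2 \in M2 ->
  (forall x, exists2 y, y \in M1 & connect e1 x y) ->
  (forall x, exists2 y, y \in M2 & connect e2 x y) ->
  connected_graph (glue e1 e2 M1 M2).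
Proof.
move=> [_ sym] x1M x2M c1 c2; split; first by case: (m1) x1 {x1M c1} => [[]|].
set e := glue _ _ _ _.
have csym : connect_sym e by apply: sym_connect_sym.
have cl x y : connect e1 x y -> connect e (lshift m2 x) (lshift m2 y).
  case/connectP => p; elim: p x => [|z p IHp] x /=; first by move=> _ ->.
  case/andP=> exz pz /(IHp _ pz); apply: connect_trans.
  by apply: connect1; rewrite /e /glue !splitE.
have cr x y : connect e2 x y -> connect e (rshift m1 x) (rshift m1 y).
  case/connectP => p; elim: p x => [|z p IHp] x /=; first by move=> _ ->.
  case/andP=> exz pz /(IHp _ pz); apply: connect_trans.
  by apply: connect1; rewrite /e /glue !splitE.
have cross x y : x \in M1 -> y \in M2 -> connect e (lshift m2 x) (rshift m1 y).
  by move=> xM yM; apply: connect1; rewrite /e /glue !splitE xM.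
suff to u : connect e u (lshift m2 x1).
  by move=> x y; apply: connect_trans (to x) _; rewrite csym.
move: u; apply: ord_sum_ind => x.
  have [y yM /cl] := c1 x; move/connect_trans; apply.
  apply: connect_trans (cross _ _ yM x2M) _; rewrite csym; exact: cross.
have [y yM /cr] := c2 x; move/connect_trans; apply.
by rewrite csym; apply: cross.
Qed.

(** * Complete graphs *)

Definition clique a : rel 'I_a := fun x y => x != y.

Lemma clique_simple a : simple_graph (@clique a).
Proof. by split=> [x | x y]; rewrite /clique ?eqxx // eq_sym. Qed.

Lemma indep_clique a A : indep (@clique a) A = (#|A| <= 1)%N.
Proof.
apply/indepP/card_le1_eqP => h x y xA yA.
  by have := h x y xA yA; rewrite /clique negbK => /eqP.
by rewrite /clique negbK; apply/eqP; apply: h.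
Qed.

Lemma indep_poly_clique a : indep_poly (@clique a) setT = 1 + a%:R * 'X.
Proof.
have sumk (k : nat) : \sum_(A : {set 'I_a} | #|A| == k) 'X^#|A|
    = 'C(a, k)%:R * 'X^k :> {poly int}.
  rewrite (eq_bigr (fun=> 'X^k)); last by move=> A /eqP ->.
  by rewrite sumr_const mulr_natl -cardsE card_draws card_ord.
rewrite /indep_poly (bigID (fun A : {set 'I_a} => #|A| == 0%N)) /=.
rewrite (eq_bigl (fun A : {set 'I_a} => #|A| == 0%N)); last first.
  by move=> A; rewrite subsetT indep_clique; case: #|A| => [|[|]].
rewrite sumk (eq_bigl (fun A : {set 'I_a} => #|A| == 1%N)); last first.
  by move=> A; rewrite subsetT indep_clique; case: #|A| => [|[|]].
by rewrite sumk bin0 bin1 mul1r expr1.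
Qed.

(** With at least two vertices there is an edge, so the empty set leaves a dependent remainder. *)
Lemma v_lower_clique a : v_lower (@clique a.+2) setT 1.
Proof.
move=> A _ _; rewrite lt0n; apply: contraL => /eqP/cards0_eq ->.
have -> : nbh (@clique a.+2) set0 = set0.
  by apply/setP => y; rewrite in_set0; apply/nbhP => -[x]; rewrite in_set0.
by rewrite setD0 indep_clique cardsT card_ord.
Qed.

Lemma v_witness_clique a : v_witness (@clique a.+1) set0 1.
Proof.
exists [set ord0]; rewrite sub0set !indep_clique cards1; split=> //.
apply: (@leq_trans #|[set ord0 : 'I_a.+1]|); last by rewrite cards1.
apply: subset_leq_card; apply/subsetP => y; rewrite in_setC in_set1.
by apply: contraR => y0; apply/nbhP; exists ord0; rewrite ?inE // /clique eq_sym.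
Qed.

(** * The graphs *)

Lemma indep_poly0 m (e : rel 'I_m) : indep_poly e set0 = 1.
Proof.
rewrite /indep_poly (big_pred1 set0) ?cards0 // => A.
rewrite subset0 /=; case: eqP => //= ->.
by apply/indepP => x; rewrite inE.
Qed.

Lemma v_lower0 m (e : rel 'I_m) D : v_lower e D 0.
Proof. by []. Qed.

Definition union m1 m2 (e1 : rel 'I_m1) (e2 : rel 'I_m2) := glue e1 e2 set0 set0.
Definition join m1 m2 (e1 : rel 'I_m1) (e2 : rel 'I_m2) := glue e1 e2 setT setT.

(** Here [k] is only a lower bound for the v-number; witnesses are built separately. *)
Definition graph_data m (e : rel 'I_m) (P : {poly int}) (k : nat) :=
  [/\ simple_graph e, indep_poly e setT = P & v_lower e setT k].

Lemma graph_data_clique a :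
  graph_data (@clique a.+2) (1 + a.+2%:R * 'X) 1.
Proof.
by split; [exact: clique_simple | exact: indep_poly_clique | exact: v_lower_clique].
Qed.

Lemma graph_data_union m1 m2 (e1 : rel 'I_m1) (e2 : rel 'I_m2) P1 P2 k1 k2 :
  graph_data e1 P1 k1 -> graph_data e2 P2 k2 ->
  graph_data (union e1 e2) (P1 * P2) (k1 + k2).
Proof.
case=> s1 <- v1 [s2 <- v2]; split; first exact: glue_simple.
  by rewrite -set_sumT indep_poly_glue !setD0 addrK.
by rewrite -set_sumT; apply: (v_lower_glue (l1 := k1) (l2 := k2) v1 v2); rewrite ?setD0.
Qed.

Lemma graph_data_join m1 m2 (e1 : rel 'I_m1) (e2 : rel 'I_m2) P1 P2 k1 k2 :
  graph_data e1 P1 k1 -> graph_data e2 P2 k2 ->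
  graph_data (join e1 e2) (P1 + P2 - 1) (minn k1 k2).
Proof.
case=> s1 <- v1 [s2 <- v2]; split; first exact: glue_simple.
  by rewrite -set_sumT indep_poly_glue !setDT !indep_poly0 !mulr1 mul1r.
rewrite -set_sumT; apply: (v_lower_glue (l1 := 0) (l2 := 0) v1 v2) => // [|_|_]; lia.
Qed.

(* The sizes are chosen so that the numbers (V, E, T) of independent sets of
   sizes 1, 2, 3 are (18, 33, 16) for [core], giving (1+x)^2 (1+16x), and
   (16, 32, 16) for [connector], giving 1 + 16x (1+x)^2. *)
Definition core :=
  join (union (@clique 3) (@clique 3))
    (join (union (union (@clique 2) (@clique 2)) (@clique 2))
          (union (union (@clique 2) (@clique 2)) (@clique 2))).

Definition connector :=
  join (union (union (@clique 2) (@clique 2)) (@clique 4))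
       (union (@clique 2) (@clique 6)).

Lemma graph_data_core :
  graph_data core ((1 + 'X) ^+ 2 * (1 + 16%:R * 'X)) 2.
Proof.
have K2 := graph_data_clique 0.
have K2_3 := graph_data_union (graph_data_union K2 K2) K2.
have K3_2 := graph_data_union (graph_data_clique 1) (graph_data_clique 1).
case: (graph_data_join K3_2 (graph_data_join K2_3 K2_3)) => s P v.
by split=> //; rewrite P; ring.
Qed.

Lemma graph_data_connector :
  graph_data connector (1 + 16%:R * 'X * (1 + 'X) ^+ 2) 2.
Proof.
have K2 := graph_data_clique 0.
have K224 := graph_data_union (graph_data_union K2 K2) (graph_data_clique 2).
have K26 := graph_data_union K2 (graph_data_clique 4).
case: (graph_data_join K224 K26) => s P v.
by split=> //; rewrite P; ring.
Qed.

Lemma v_witness_core : v_witness core set0 2.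
Proof.
have K3 := v_witness_clique 2.
apply: (v_witness_sub (sub0set _)); apply: v_witness_join => //.
exact: (v_witness_sub (sub0set _) (v_witness_glue K3 K3)).
Qed.

(** Induction invariant for [n.+1] blocks: [M] collects the connectors and [~: M] the cores. The
    clauses on [~: M] feed the gluing formulas, which delete marks. *)
Definition linked_data n m (e : rel 'I_m) (M : {set 'I_m}) :=
  [/\ graph_data e ((1 + 'X) ^+ (2 * n.+1) * (1 + 16%:R * 'X) ^+ n *
        (1 + (16 * n.+2)%:R * 'X)) (2 * n.+1),
      indep_poly e (~: M) = ((1 + 'X) ^+ 2 * (1 + 16%:R * 'X)) ^+ n.+1,
      v_lower e (~: M) (2 * n.+1), v_witness e M (2 * n.+1) &
      connected_graph e /\ exists x, x \in M].

Lemma linked_data1 : linked_data 0 (join core connector) (set_sum set0 setT).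
Proof.
have [sZ PZ vZ] := graph_data_core; have [sY PY vY] := graph_data_connector.
have [s P v] := graph_data_join graph_data_core graph_data_connector.
have CM m1 m2 : ~: set_sum set0 [set: 'I_m2] = set_sum [set: 'I_m1] set0.
  by rewrite set_sumC setC0 setCT.
split.
- by split=> //; rewrite P; ring.
- by rewrite CM indep_poly_glue !setDT !indep_poly0 PZ; ring.
- rewrite CM; apply: (v_lower_glue (l1 := 0) (l2 := 0) vZ (@v_lower0 _ _ _)) => //.
  by rewrite -setI_eq0 set0I eqxx.
- exact: v_witness_join v_witness_core.
split; last by exists (rshift _ ord0); rewrite in_set_sumE inE.
by apply: (glue_connected (x1 := ord0) (x2 := ord0)) => // x; exists x; rewrite ?inE.
Qed.

Lemma linked_dataS n m (e : rel 'I_m) M : linked_data n e M ->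
  linked_data n.+1 (glue (join core connector) e (set_sum set0 setT) M)
    (set_sum (set_sum set0 setT) M).
Proof.
have [[s1 P1 v1] Q1 l1 w1 [[_ c1] [x1 x1M]]] := linked_data1.
case=> [[s2 P2 v2] Q2 l2 w2 [[_ c2] [x2 x2M]]].
have DC m' (A : {set 'I_m'}) : ~: A :\: A = ~: A by rewrite setDE setIid.
have k2 : (2 * n.+2 = 2 * 1 + 2 * n.+1)%N by lia.
have simp := glue_simple (set_sum set0 setT) M s1 s2.
split.
- split=> //.
    (* After removing common factors the claim is (1+32x) + (1+16(n+2)x) - (1+16x) = 1+16(n+3)x. *)
    rewrite -(set_sumT _ m) indep_poly_glue !setTD P1 P2 Q1 Q2 k2.
    rewrite (exprMn n.+1) -exprM exprD !(exprS _ n).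
    move: ((1 + 'X) ^+ (2 * n.+1)) ((1 + 16%:R * 'X) ^+ n) => a b; ring.
  (* Deleting the connectors keeps the lower bound of each side, so all three cases give the same
     sum. *)
  rewrite k2 -(set_sumT _ m); apply: (v_lower_glue (l1 := 2 * 1) (l2 := 2 * n.+1) v1 v2); by rewrite ?setTD.
- by rewrite set_sumC indep_poly_glue !DC Q1 Q2 addrK expr1 exprS.
- by rewrite k2 set_sumC; apply: (v_lower_glue (l1 := 2 * 1) (l2 := 2 * n.+1) l1 l2); rewrite ?DC.
- by rewrite k2; apply: v_witness_glue.
split; last by exists (lshift _ x1); rewrite in_set_sumE.
apply: (glue_connected simp x1M x2M) => x; first by exists x1.
by exists x2.
Qed.

Lemma linked_graph n : exists m (e : rel 'I_m) M, linked_data n e M.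
Proof.
elim: n => [|n [m [e [M /linked_dataS h]]]]; last by do 3!eexists; exact: h.
by do 3!eexists; exact: linked_data1.
Qed.

(** * The degree of the h-polynomial *)

Lemma size_linear (a : nat) : (0 < a)%N -> size (1 + a%:R * 'X : {poly int}) = 2.
Proof.
rewrite lt0n => a0; rewrite addrC -polyC_natr -polyC1 size_MXaddC oner_eq0 andbF.
by rewrite size_polyC pnatr_eq0 a0.
Qed.

Lemma hpoly_of1 : hpoly_of 0 1 = 1.
Proof. by rewrite /hpoly_of big_ord1 coef1 expr0 mulr1 scale1r. Qed.

Lemma hpoly_of_linearX D k (a : nat) (P : {poly int}) : (size P <= D.+1)%N ->
  (size ((1 + a%:R * 'X) ^+ k * P)%R <= (k + D).+1)%N /\
  hpoly_of (k + D) ((1 + a%:R * 'X) ^+ k * P) =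
    (1 + (a%:R - 1) * 'X) ^+ k * hpoly_of D P.
Proof.
move=> szP; elim: k => [|k [szk IHk]]; first by rewrite !expr0 !mul1r.
rewrite !exprS -!mulrA hpoly_of_linear // IHk; split=> //.
apply: leq_trans (size_polyMleq _ _) _.
have sz2 : (size (1 + a%:R * 'X : {poly int})%R <= 2)%N.
  case: a {szk IHk} => [|a]; last by rewrite size_linear.
  by rewrite mul0r addr0 size_poly1.
by rewrite -subn1 leq_subLR (leq_trans (leq_add sz2 szk)).
Qed.

(* Every copy has independence number 3, so the Krull dimension is [3 * n.+1];
   the factor [1 + X] contributes [1] to the h-polynomial. *)
Lemma hpoly_linked n :
  let P := (1 + 'X) ^+ (2 * n.+1) * (1 + 16%:R * 'X) ^+ n *
    (1 + (16 * n.+2)%:R * 'X) in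
  (size P <= (3 * n.+1).+1)%N /\
  hpoly_of (3 * n.+1) P =
    (1 + 15%:R * 'X) ^+ n * (1 + (16 * n.+2 - 1)%:R * 'X).
Proof.
have sz1 : (size (1%R : {poly int}) <= 1)%N by rewrite size_poly1.
have [s1 h1] := hpoly_of_linearX 1 (16 * n.+2) sz1.
have [s2 h2] := hpoly_of_linearX n 16 s1.
have [s3 h3] := hpoly_of_linearX (2 * n.+1) 1 s2.
rewrite !mul1r subrr mul0r addr0 expr1n mul1r h2 h1 hpoly_of1 !expr1 !mulr1 in s3 h3.
have -> : (3 * n.+1 = 2 * n.+1 + (n + (1 + 0)))%N by lia.
rewrite -mulrA; split=> //; rewrite h3 natrB //.
by congr ((1 + _ * 'X) ^+ n * _); ring.
Qed.

Theorem theorem3p4 :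
  forall n : nat, (0 < n)%N ->
  exists (m : nat) (e : rel 'I_m),
    simple_graph e /\ connected_graph e /\
    forall K : fieldType,
      exists (v : nat) (h : {poly int}),
        is_vnumber (@edge_ideal K m e) v /\ is_hpoly (@edge_ideal K m e) h /\
        (v%:Z - ((size h).-1)%:Z = n%:Z)%R.
Proof.
case=> // n _; have [m [e [M [[simp P v] _ _ w [conn _]]]]] := linked_graph n.
have [szP hP] := hpoly_linked n; rewrite -P in szP hP.
have [irr sym] := simp.
exists m, e; split=> //; split=> // K.
(* The target is now [n.+1]: there are [n.+1] blocks, the v-number is twice that, and h has degree
   [n.+1]. *)
exists (2 * n.+1)%N, ((1 + 15%:R * 'X) ^+ n * (1 + (16 * n.+2 - 1)%:R * 'X)).
split; first by apply: is_vnumber_edge_ideal => //; apply: v_witness_sub w; exact: sub0set.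
split.
  apply: (is_hpoly_edge_ideal _ irr szP (esym hP)).
  (* The value at 1 is 16^n times 16(n+2). *)
  rewrite !hornerE -!polyC_natr !hornerE.
  by rewrite mulf_neq0 ?expf_neq0 //; lia.
have sz16 : size (1 + (16 * n.+2 - 1)%:R * 'X : {poly int}) = 2%N.
  by apply: size_linear; lia.
have nz : (1 + 15%:R * 'X : {poly int}) != 0 by rewrite -size_poly_eq0 size_linear.
have szX : size ((1 + 15%:R * 'X : {poly int}) ^+ n) = n.+1.
  by rewrite -(prednK (n := size _)) ?size_poly_gt0 ?expf_neq0 // size_exp
    size_linear // mul1n.
rewrite size_mul ?expf_neq0 // -?size_poly_eq0 ?sz16 // szX addn2 /=; lia.
Qed.
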